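(* Let $n\in\{2,3\}$, and let $d_i=\|a_i-x^o\|+r_i$, $i=1,2,\ldots$, be range measurements of an object at $x^o\in\mathbb R^n$ by sensors at $a_i\in\mathbb R^n$, satisfying assumptions (A1), (A2), (A3), (A6) of the context. For each $m$ let $A\in\mathbb R^{m\times(n+1)}$ be the matrix with $i$-th row $[-2a_i^\top\ \ 1]$ and $\bar b\in\mathbb R^m$ the vector with $i$-th entry $d_i^2-\|a_i\|^2$. Let $\hat y^{\rm NEL}_m=(A^\top A)^{-1}A^\top\bar b$ be the optimal solution (the Noise-Est-Lin estimator) of $\mathop{\rm minimize}_{\bar y\in\mathbb R^{n+1}}\|A\bar y-\bar b\|^2$, and let $\bar y^o=[{x^o}^\top\ \ \|x^o\|^2+\sigma^2]^\top$. Then the Noise-Est-Lin estimator is $\sqrt m$-consistent, i.e. $\hat y^{\rm NEL}_m-\bar y^o=O_p(1/\sqrt m)$.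
   Context: $X_m=O_p(\alpha_m)$ means that $X_m/\alpha_m$ is stochastically bounded: for every $\epsilon>0$ there exist finite $M,N$ such that $P(|X_m/\alpha_m|>N)<\epsilon$ for all $m>M$ (with the norm in place of the absolute value for vectors). The formula for $\hat y^{\rm NEL}_m$ is used for those $m$ for which $A^\top A$ is invertible (all sufficiently large $m$ under the assumptions). The sample distribution function of a sequence $(z_1,z_2,\ldots)$ in $\mathbb R^n$ is $F_m(z)=\#\{i\le m: z_i\preceq z\}/m$, where $\preceq$ is the coordinatewise inequality. Assumptions. (A1) The $r_i$ are i.i.d. Gaussian with mean $0$ and finite variance $\sigma^2$. (A2) $x^o$ is an interior point of a compact set $\mathcal X\subset\mathbb R^n$; all the (deterministic) sensor positions $a_i$ lie in a bounded set $\mathcal A\subset\mathbb R^n$, and $a_i\notin\mathcal X$ for each $i$. (A3) The sample distribution function $F_m$ of $(a_1,a_2,\ldots)$ converges to a distribution function $F_\mu$, i.e. $F_m(a)\to F_\mu(a)$ at every continuity point $a\in\mathbb R^n$ of $F_\mu$; $\mu$ denotes the probability measure generated by $F_\mu$. (A6) There is no (affine) line $\mathcal S$ (if $n=2$), respectively plane $\mathcal S$ (if $n=3$), such that $\mu(\mathcal S)=1$. *)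

(* Defs.v *)
From mathcomp Require Import all_boot all_order all_algebra.
From mathcomp Require Import all_classical all_reals all_analysis.

Set Implicit Arguments.
Unset Strict Implicit.
Unset Printing Implicit Defensive.

Import Order.TTheory GRing.Theory Num.Theory.
Import numFieldNormedType.Exports.

Local Open Scope classical_set_scope.
Local Open Scope ring_scope.

(* The library norm `|x| on matrices is the sup norm. *)
Definition enorm (R : realType) (n : nat) (x : 'cV[R]_n) : R :=
  Num.sqrt (\sum_(k < n) x k 0 ^+ 2).

Definition vle (R : realType) (n : nat) (x y : 'cV[R]_n) : bool :=
  [forall k, x k 0 <= y k 0].

(* R^n with its Borel sigma-algebra. *)
Definition borel_vec (R : realType) (n : nat) :=
  g_sigma_algebraType (@open 'cV[R]_n).

(* Sequences are indexed from 0: the first m terms are a 0, ..., a m.-1. *)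
Definition sample_df (R : realType) (n : nat) (a : nat -> 'cV[R]_n) (m : nat)
    (z : 'cV[R]_n) : R :=
  #|[set i : 'I_m | vle (a i) z]|%:R / m%:R.

Definition df (R : realType) (n : nat) (mu : probability (borel_vec R n) R)
    (z : 'cV[R]_n) : R :=
  fine (mu [set x | vle x z]).

(* k-dimensional affine subspaces: lines for k = 1, planes for k = 2. *)
Definition affine_subspace (R : realType) (n k : nat) (S : set 'cV[R]_n) : Prop :=
  exists (p : 'cV[R]_n) (V : 'M[R]_(n, k)),
    \rank V = k /\ S = [set p + V *m t | t in [set: 'cV[R]_k]].

Definition mutually_independent (d : measure_display) (T : measurableType d)
    (R : realType) (P : probability T R) (X : nat -> {RV P >-> R}) : Prop :=
  forall (J : seq nat) (B : nat -> set R),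
    uniq J -> (forall i, measurable (B i)) ->
    P (\bigcap_(i in [set` J]) X i @^-1` B i) =
      (\prod_(i <- J) P (X i @^-1` B i))%E.

(* normal_prob m 0 is by convention the uniform law on [0, 1]; the Gaussian law
   of variance 0 is the Dirac mass. *)
Definition gaussian (R : realType) (m s : R) (B : set R) : \bar R :=
  if s == 0 then \d_m B else normal_prob m s B.

Definition iid_gaussian (d : measure_display) (T : measurableType d)
    (R : realType) (P : probability T R) (X : nat -> {RV P >-> R}) (m s : R) :
    Prop :=
  mutually_independent X /\
  forall i (B : set R), measurable B -> distribution P (X i) B = gaussian m s B.

Definition bigOp (d : measure_display) (T : measurableType d) (R : realType)
    (P : probability T R) (k : nat) (X : nat -> T -> 'cV[R]_k)
    (alpha : nat -> R) : Prop :=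
  forall eps : R, 0 < eps -> exists (M : nat) (N : R), forall m : nat, (M < m)%N ->
    (P [set w | (N < enorm ((alpha m)^-1 *: X m w))%R] < eps%:E)%E.

Definition range_meas (T : Type) (R : realType) (n : nat) (a : nat -> 'cV[R]_n)
    (x : 'cV[R]_n) (r : nat -> T -> R) (i : nat) (w : T) : R :=
  enorm (a i - x) + r i w.

Definition nel_A (R : realType) (n : nat) (a : nat -> 'cV[R]_n) (m : nat) :
    'M[R]_(m, n + 1) :=
  \matrix_(i < m) row_mx ((- 2) *: (a i)^T) 1%:M.

Definition nel_b (R : realType) (n : nat) (a : nat -> 'cV[R]_n) (d : nat -> R)
    (m : nat) : 'cV[R]_m :=
  \col_(i < m) (d i ^+ 2 - enorm (a i) ^+ 2).

(* invmx M = M when M is singular, so this is the least-squares solution only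
   when A^T *m A is invertible. *)
Definition nel (R : realType) (n : nat) (a : nat -> 'cV[R]_n) (d : nat -> R)
    (m : nat) : 'cV[R]_(n + 1) :=
  let A := nel_A a m in invmx (A^T *m A) *m A^T *m nel_b a d m.

Definition nel_target (R : realType) (n : nat) (x : 'cV[R]_n) (s : R) :
    'cV[R]_(n + 1) :=
  col_mx x (enorm x ^+ 2 + s ^+ 2)%:M.

(* Main.v *)
Require Import Defs.
From HB Require Import structures.
From mathcomp Require Import all_boot all_order all_algebra.
From mathcomp Require Import all_classical all_reals all_analysis measurable_realfun.
From mathcomp Require Import ring lra.

Set Implicit Arguments.
Unset Strict Implicit.
Unset Printing Implicit Defensive.

Import Order.TTheory GRing.Theory Num.Theory.
Import numFieldNormedType.Exports.

Local Open Scope classical_set_scope.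
Local Open Scope ring_scope.

(** The error [y = nel - target] solves [A^T A y = A^T e], where
    [e_i = 2 rho_i r_i + r_i^2 - sigma^2] and [rho_i = |a_i - xo|].  The [e_i] are
    independent, centered and of bounded variance, so each entry of [A^T e] has
    second moment [O(m)].  On the other side [u^T A^T A u >= c m |u|^2] for large
    [m]: if [u <> 0], (A6) makes the set where the affine form [x |-> (-2x^T, 1) u]
    is nonzero [mu]-charged; hence so is a box on which the form is bounded away
    from zero, and the corners of the box may be taken on a grid avoiding the
    countably many atoms of the coordinates, so that by (A3) a positive fraction
    of the sensors falls into the box.  Compactness of the unit sphere makes [c]
    uniform in [u].  Therefore [|y| = O(|A^T e| / m)], and Markov's inequality
    concludes. *)

(** * Moments of the Gaussian law *)

Section density.
Local Open Scope ereal_scope.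
Context d (T : measurableType d) (R : realType).
Variables (mu nu : {measure set T -> \bar R}) (p : T -> R).
Hypotheses (mp : measurable_fun setT p) (p0 : forall x, (0 <= p x)%R).
Hypothesis nuE : forall A, measurable A -> nu A = \int[mu]_(x in A) (p x)%:E.

Import HBNNSimple.

Let density_indic A : measurable A ->
  \int[nu]_x (\1_A x)%:E = \int[mu]_x ((\1_A x)%:E * (p x)%:E).
Proof.
move=> mA; rewrite integral_indic// setIT nuE// integral_mkcond.
apply: eq_integral => x _; rewrite patchE indicE.
by case: ifPn => _; rewrite ?mul1e ?mul0e.
Qed.

Let density_nnsfun (f : {nnsfun T >-> R}) :
  \int[nu]_x (f x)%:E = \int[mu]_x ((f x)%:E * (p x)%:E).
Proof.
have mpE : measurable_fun [set: T] (EFin \o p) by exact/measurable_EFinP.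
under [LHS]eq_integral do rewrite fimfunE -fsumEFin//.
rewrite [LHS]ge0_integral_fsum//; last 2 first.
  - by move=> r; exact/measurable_EFinP/measurableT_comp.
  - by move=> r x _; rewrite EFinM nnfun_muleindic_ge0.
under [RHS]eq_integral.
  move=> x xD; rewrite fimfunE -fsumEFin// muleC ge0_mule_fsumr; last first.
    by move=> r; rewrite EFinM nnfun_muleindic_ge0.
  over.
rewrite [RHS]ge0_integral_fsum//; last 2 first.
  - move=> r; apply: emeasurable_funM => //.
    by apply/measurable_EFinP; do 2 apply/measurableT_comp => //.
  - move=> r x _; apply: mule_ge0; first by rewrite lee_fin.
    by rewrite EFinM nnfun_muleindic_ge0.
apply: eq_fsbigr => r _.
rewrite integralZl_indic_nnsfun//= density_indic//.
(* A negative [r] has empty preimage under the nonnegative [f], so both sides vanish; otherwise [r]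
   can be moved out of the integral. *)
have [rf|rf] := ltP r 0%R.
  rewrite preimage_nnfun0// indic0 integral0_eq ?mule0; last first.
    by move=> x _; rewrite mul0e.
  by rewrite integral0_eq// => x _; rewrite mulr0 mule0.
rewrite -ge0_integralZl//.
- by apply: eq_integral => x _; rewrite EFinM [RHS]muleC muleA.
- apply: emeasurable_funM => //.
  by apply/measurable_EFinP; exact: measurable_indic.
- by move=> x _; apply: mule_ge0; rewrite lee_fin.
Qed.

(** The hypothesis [nuE] is the case of indicators; linearity extends it to simple functions, and
    monotone convergence along [nnsfun_approx] to nonnegative functions. *)
Lemma ge0_integral_density (f : T -> \bar R) :
  measurable_fun setT f -> (forall x, 0 <= f x) ->
  \int[nu]_x f x = \int[mu]_x (f x * (p x)%:E).
Proof.
move=> mf f0; have mpE : measurable_fun [set: T] (EFin \o p) by exact/measurable_EFinP.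
pose f_ := nnsfun_approx measurableT mf.
transitivity (lim (\int[nu]_x (f_ n x)%:E @[n --> \oo])).
  rewrite -monotone_convergence//=.
  - apply: eq_integral => ? /[!inE] xD; apply/esym/cvg_lim => //=.
    exact: cvg_nnsfun_approx.
  - by move=> n; exact/measurable_EFinP/measurable_funTS.
  - by move=> n ? _; rewrite lee_fin.
  - by move=> ? _ ? ? mn; rewrite lee_fin; exact/lefP/nd_nnsfun_approx.
under eq_fun do rewrite density_nnsfun.
rewrite -monotone_convergence//=.
- apply: eq_integral => x _; apply/cvg_lim => //=.
  by apply: cvgeZr => //; exact: cvg_nnsfun_approx.
- by move=> n; apply: emeasurable_funM => //; exact/measurable_EFinP/measurable_funTS.
- by move=> n x _; rewrite mule_ge0 ?lee_fin.
- by move=> x _ m n mn; rewrite lee_wpmul2r ?lee_fin//; exact/lefP/nd_nnsfun_approx.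
Qed.

(** Multiplying by [p >= 0] commutes with taking positive and negative parts. *)
Lemma integral_density (f : T -> \bar R) : measurable_fun setT f ->
  \int[nu]_x f x = \int[mu]_x (f x * (p x)%:E).
Proof.
move=> mf; rewrite [LHS]integralE [RHS]integralE.
rewrite !ge0_integral_density//; [|exact: measurable_funeneg|exact: measurable_funepos].
congr (_ - _); apply: eq_integral => x _.
  by rewrite !funeposE maxe_pMl ?mul0e ?lee_fin.
by rewrite !funenegE maxe_pMl ?mul0e ?lee_fin// mulNe.
Qed.

End density.

Section gaussian_moments.
Context (R : realType).
Local Notation lambda := (@lebesgue_measure R).

(** The integral over a symmetric interval is the difference of [F] at the endpoints, which tends to
    0; dominated convergence with bound [|f|] passes to the whole line. This stands in for
    integration by parts. *)
Lemma integral_derivative_eq0 (f F : R -> R) :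
    lambda.-integrable [set: R] (EFin \o f) -> continuous f ->
    (forall x : R, is_derive x 1 F (f x)) ->
    F n%:R @[n --> \oo] --> 0 -> F (- n%:R) @[n --> \oo] --> 0 ->
  (\int[lambda]_x (f x)%:E = 0)%E.
Proof.
move=> intf cf dF Fy FNy.
have mfE : measurable_fun [set: R] (EFin \o f) by exact: measurable_int intf.
(* The successor keeps the interval nondegenerate at [n = 0], as the fundamental theorem of calculus
   demands. *)
pose D n := `[- n.+1%:R, n.+1%:R]%classic : set R.
pose f_ n : R -> \bar R := (EFin \o f) \_ (D n).
have [] := @dominated_convergence _ _ R lambda setT measurableT f_ (EFin \o f)
  (abse \o (EFin \o f)).
- move=> n; apply: (iffLR (measurable_restrictT _ _)); first exact: measurable_itv.
  apply/measurable_EFinP; apply: measurable_funTS; exact: continuous_measurable_fun.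
- exact: mfE.
- apply: aeW => x _; apply: cvg_near_cst.
  have [k xk] : exists k, `|x| < k%:R by exists (Num.bound `|x|); rewrite archi_boundP.
  exists k => // n /= kn; rewrite /f_ patchE mem_set// /D /= in_itv /= -ler_norml.
  by rewrite (le_trans (ltW xk))// ler_nat leqW.
- exact: integrable_abse.
- apply: aeW => x n _; rewrite /f_ patchE; case: ifPn => // _.
  by rewrite abse0 abse_ge0.
move=> _ _.
have -> : [sequence (\int[lambda]_x f_ n x)%E]_n =
    (fun n => (F n.+1%:R - F (- n.+1%:R))%:E).
  apply/funext => n; rewrite /= -integral_mkcond.
  have n0 : - n.+1%:R < n.+1%:R :> R by rewrite gtrN.
  have cF : continuous F.
    by move=> x; apply/differentiable_continuous/derivable1_diffP; exact: ex_derive.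
  rewrite (@continuous_FTC2 _ f F)//.
  - exact/continuous_subspaceT.
  - split.
    + by move=> x _; exact: ex_derive.
    + by apply: cvg_at_right_filter; exact: cF.
    + by apply: cvg_at_left_filter; exact: cF.
  - by move=> x _; rewrite derive1E; exact: derive_val.
move=> lim1.
have lim2 : (F n.+1%:R - F (- n.+1%:R))%:E @[n --> \oo] --> 0%:E.
  apply: cvg_EFin; first exact: nearW.
  rewrite /= -[X in _ --> X]subr0; apply: (@cvgB _ R^o).
  - by move: Fy; rewrite -(cvg_shiftS (fun n => F n%:R)).
  - by move: FNy; rewrite -(cvg_shiftS (fun n => F (- n%:R))).
exact: (cvg_unique _ lim1 lim2).
Qed.

End gaussian_moments.

Lemma cvg0_bounded_muln (R : realType) (u : nat -> R) (C : R) :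
  (forall n, `|u n| * n%:R <= C) -> u n @[n --> \oo] --> 0.
Proof.
move=> uC; rewrite -(cvg_shiftS u); apply/norm_cvg0P.
apply: (@squeeze_cvgr _ _ _ _ (fun=> 0) (fun n => C * harmonic n)).
- apply: nearW => n; rewrite normr_ge0/= /harmonic /=.
  by rewrite ler_pdivlMr ?ltr0n// uC.
- exact: cvg_cst.
- rewrite -[X in _ --> X](mulr0 C); apply: cvgM; first exact: cvg_cst.
  exact: cvg_harmonic.
Qed.

Lemma ler_normX_1D (R : realDomainType) (x : R) (i j : nat) : (i <= j)%N ->
  `|x| ^+ i <= 1 + `|x| ^+ j.
Proof.
move=> ij; have [x1|x1] := leP `|x| 1.
  by rewrite (le_trans (exprn_ile1 _ _ _))// lerDl exprn_ge0.
by rewrite (le_trans (ler_weXn2l (ltW x1) ij))// lerDr.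
Qed.

(** * Moments of the nondegenerate centered normal law *)

Section normal_moments.
Context (R : realType) (s : R).
Hypothesis s0 : 0 < s.
Local Notation lambda := (@lebesgue_measure R).
Local Notation phi := (normal_pdf 0 s).

Let k : R := (s ^+ 2 *+ 2)^-1.

Let phiE : phi = fun x => normal_peak s * expR (- (k * x ^+ 2)).
Proof.
rewrite normal_pdfE ?gt_eqF//; apply/funext => x; congr (_ * expR _).
by rewrite subr0 mulNr mulrC.
Qed.

Let is_derive_phi (x : R) : is_derive x 1 phi (- (s ^- 2 * x * phi x)).
Proof.
rewrite phiE; apply: is_derive_eq.
rewrite /k /GRing.scale /=; field.
by rewrite gt_eqF.
Qed.

Let K : R := 64 * s ^+ 4 * normal_peak s / normal_peak (2 * s).

Let K0 : 0 <= K.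
Proof. by rewrite /K !mulr_ge0 ?invr_ge0 ?exprn_ge0 ?normal_peak_ge0// ltW. Qed.

(** A normal density of twice the deviation absorbs the factor [x^4]. With [t = x^2 / (8 s^2)] the
    two exponentials are [exp(-4t)] and [exp(-t)], and [x^4 = 64 s^4 t^2]; now [t <= exp t] gives
    [t^2 exp(-4t) <= exp(-2t) <= exp(-t)]. The quotient of peaks in [K] adjusts the
    normalization. *)
Let x4phi_le x : x ^+ 4 * phi x <= K * normal_pdf 0 (2 * s) x.
Proof.
have s20 : 2 * s != 0 by rewrite mulf_neq0 ?gt_eqF.
rewrite phiE (normal_pdfE _ s20) /normal_fun subr0 /K.
pose t := x ^+ 2 / (8 * s ^+ 2).
have sn0 : s != 0 by rewrite gt_eqF.
have t0 : 0 <= t.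
  by apply: divr_ge0; [exact: sqr_ge0|apply: mulr_ge0; rewrite ?ler0n ?sqr_ge0].
have -> : k * x ^+ 2 = 4 * t by rewrite /k /t; field.
have -> : - x ^+ 2 / ((2 * s) ^+ 2 *+ 2) = - t.
  by rewrite /t; field.
have -> : x ^+ 4 = 64 * s ^+ 4 * t ^+ 2 by rewrite /t; field.
have p0 : 0 < normal_peak (2 * s) by rewrite normal_peak_gt0.
rewrite [leRHS]mulrA divfK ?gt_eqF//.
rewrite -[leLHS]mulrA [t ^+ 2 * _]mulrCA [leLHS]mulrA.
rewrite ler_wpM2l//.
  by rewrite !mulr_ge0 ?exprn_ge0 ?normal_peak_ge0// ltW.
have tE : t <= expR t by rewrite (le_trans _ (expR_ge1Dx t))// lerDr.
have -> : expR (- (4 * t)) = expR (- t) ^+ 2 * expR (- (2 * t)).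
  by rewrite -expRM_natl -expRD; congr expR; ring.
rewrite mulrA -exprMn; apply: (@le_trans _ _ (1 * expR (- (2 * t)))).
  rewrite ler_wpM2r ?expR_ge0// expr_le1// ?(mulr_ge0 t0) ?expR_ge0//.
  by rewrite expRN ler_pdivrMr ?expR_gt0// mul1r.
by rewrite mul1r ler_expR; lra.
Qed.

Lemma integrable_x4_normal_pdf :
  lambda.-integrable setT (fun x => (x ^+ 4 * phi x)%:E).
Proof.
apply: (@le_integrable _ _ _ lambda setT measurableT _
    (fun x => (K%:E * (normal_pdf 0 (2 * s) x)%:E)%E)).
- apply/measurable_EFinP; apply: measurable_funM.
    exact: measurable_funX.
  exact: measurable_normal_pdf.
- move=> x _; rewrite -EFinM !abse_EFin lee_fin.
  rewrite !ger0_norm ?x4phi_le// mulr_ge0 ?normal_pdf_ge0//.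
  by rewrite exprn_even_ge0.
- exact/integrableZl/integrable_normal_pdf.
Qed.

(** Domination by [phi + x^4 phi], through [|x|^i <= 1 + |x|^4]. *)
Lemma integrable_exprn_normal_pdf i : (i <= 4)%N ->
  lambda.-integrable setT (fun x => (x ^+ i * phi x)%:E).
Proof.
move=> i4; apply: (@le_integrable _ _ _ lambda setT measurableT _
    (fun x => ((phi x)%:E + (x ^+ 4 * phi x)%:E)%E)).
- apply/measurable_EFinP; apply: measurable_funM.
    exact: measurable_funX.
  exact: measurable_normal_pdf.
- move=> x _; rewrite -EFinD !abse_EFin lee_fin normrM normrX.
  rewrite -[X in _ <= `|X + _|]mul1r -mulrDl normrM ler_wpM2r//.
  rewrite [leRHS]ger0_norm ?addr_ge0 ?exprn_even_ge0//.
  by rewrite (le_trans (ler_normX_1D x i4))// -normrX ger0_norm ?exprn_even_ge0.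
- apply: integrableD => //; first exact: integrable_normal_pdf.
  exact: integrable_x4_normal_pdf.
Qed.

(** These are the boundary terms of the primitives used below. For [|x| = n] one has
    [|x|^(i+1) <= x^4], so [n] times the term stays bounded by [x4phi_le]. *)
Let phi_cvg0 c i : (i <= 3)%N ->
  (c * (n%:R ^+ i * phi n%:R) @[n --> \oo] --> 0) /\
  (c * ((- n%:R) ^+ i * phi (- n%:R)) @[n --> \oo] --> 0).
Proof.
move=> i3.
have bnd (x : R) (n : nat) : `|x| = n%:R ->
    `|c * (x ^+ i * phi x)| * n%:R <= `|c| * (K * normal_peak (2 * s)).
  move=> xn; rewrite !normrM (ger0_norm (normal_pdf_ge0 _ _ _)) -mulrA.
  rewrite ler_wpM2l// mulrAC normrX xn -exprSr.
  apply: (@le_trans _ _ (x ^+ 4 * phi x)).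
    rewrite ler_wpM2r ?normal_pdf_ge0//.
    rewrite -[x ^+ 4]ger0_norm ?exprn_even_ge0// normrX xn.
    case: n {xn} => [|n]; first by rewrite !expr0n.
    by rewrite ler_weXn2l// ler1n.
  rewrite (le_trans (x4phi_le x))//.
  by rewrite ler_wpM2l// normal_pdf_ub// mulf_neq0 ?gt_eqF.
split; apply: (@cvg0_bounded_muln _ _ (`|c| * (K * normal_peak (2 * s)))) => n.
  by apply: bnd; rewrite ger0_norm.
by apply: bnd; rewrite normrN ger0_norm.
Qed.

Let continuous_phi : continuous phi.
Proof. by apply: continuous_normal_pdf; rewrite gt_eqF. Qed.

(** A primitive of the integrand is [- s^2 phi]. *)
Lemma integral_x_normal_pdf : (\int[lambda]_x (x * phi x)%:E = 0)%E.
Proof.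
have [limy limNy] := @phi_cvg0 (- s ^+ 2) 0 isT.
apply: (@integral_derivative_eq0 R (fun x => x * phi x)
  ((- s ^+ 2) \*: (phi : R -> R^o))).
- exact: (@integrable_exprn_normal_pdf 1).
- by move=> x; apply: cvgM; [exact: cvg_id|exact: continuous_phi].
- move=> x; apply: is_derive_eq (is_deriveZ (- s ^+ 2) (is_derive_phi x)) _.
  by rewrite /GRing.scale /=; field; rewrite gt_eqF.
- by move: limy; under eq_fun do rewrite expr0 mul1r.
- by move: limNy; under eq_fun do rewrite expr0 mul1r.
Qed.

(** The function [- s^2 x phi] is a primitive of [(x^2 - s^2) phi], so the second moment is [s^2]
    times the total mass 1. *)
Lemma integral_x2_normal_pdf :
  (\int[lambda]_x (x ^+ 2 * phi x)%:E = (s ^+ 2)%:E)%E.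
Proof.
have [limy limNy] := @phi_cvg0 (- s ^+ 2) 1 isT.
have int2 := @integrable_exprn_normal_pdf 2 isT.
have ints : lambda.-integrable setT (fun x => ((s ^+ 2)%:E * (phi x)%:E)%E).
  exact/integrableZl/integrable_normal_pdf.
have : (\int[lambda]_x ((x ^+ 2 - s ^+ 2) * phi x)%:E = 0)%E.
  apply: (@integral_derivative_eq0 R (fun x => (x ^+ 2 - s ^+ 2) * phi x)
    ((- s ^+ 2) \*: ((id : R -> R^o) * phi))).
  - apply: eq_integrable (integrableB measurableT int2 ints) => // x _.
    by rewrite /= mulrBl EFinB EFinM.
  - move=> x; apply: cvgM; last exact: continuous_phi.
    by apply: (@cvgB _ R^o); [exact: sqr_continuous|exact: cvg_cst].
  - move=> x.
    apply: is_derive_eq (is_deriveZ _ (is_deriveM (is_derive_id x 1) (is_derive_phi x))) _.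
    by rewrite /GRing.scale /=; field; rewrite gt_eqF.
  - exact: limy.
  - exact: limNy.
have intsE : (\int[lambda]_x ((s ^+ 2)%:E * (phi x)%:E) = (s ^+ 2)%:E)%E.
  by rewrite integralZl ?integral_normal_pdf ?mule1//; exact: integrable_normal_pdf.
move=> fB0; rewrite -[LHS](@subeK _ _ (s ^+ 2)%:E)// -[RHS]add0e.
congr (_ + _)%E; rewrite -fB0 -intsE -integralB//.
by apply: eq_integral => x _; rewrite /= mulrBl EFinB [in RHS]EFinM.
Qed.

End normal_moments.

Section gaussian_law_moments.
Local Open Scope ereal_scope.
Context (R : realType) (nu : {measure set (measurableTypeR R) -> \bar R}) (s : R).
Hypotheses (s0 : (0 <= s)%R)
  (nuE : forall B : set R, measurable B -> nu B = gaussian 0 s B).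

(** For [s = 0] the law is the Dirac mass at 0; otherwise it has the normal density. *)
Let integral_gaussian (f : R -> \bar R) : measurable_fun [set: R] f ->
  \int[nu]_x f x =
  if s == 0%R then f 0%R else \int[lebesgue_measure]_x (f x * (normal_pdf 0 s x)%:E).
Proof.
move=> mf; case: ifPn => [/eqP sE|sn0].
  rewrite (@eq_measure_integral _ _ _ setT (dirac (0%R : measurableTypeR R))); last first.
    by move=> A mA _; rewrite nuE// /gaussian sE eqxx.
  by rewrite integral_dirac//= diracT mul1e.
apply: integral_density => //.
- exact: measurable_normal_pdf.
- by move=> x; exact: normal_pdf_ge0.
- by move=> A mA; rewrite nuE// /gaussian (negbTE sn0).
Qed.

Lemma integrable_exprn_gaussian i : (i <= 4)%N ->
  nu.-integrable [set: R] (fun x => (x ^+ i)%:E).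
Proof.
move=> i4; apply/integrableP; split.
  by apply/measurable_EFinP; exact: measurable_funX.
rewrite integral_gaussian; last first.
  by apply/measurableT_comp => //; apply/measurable_EFinP; exact: measurable_funX.
case: ifPn => [_|sn0]; first by rewrite ltry.
have s1 : (0 < s)%R by rewrite lt_neqAle eq_sym sn0.
have /integrableP[_] := integrable_exprn_normal_pdf s1 i4.
congr (_ < _); apply: eq_integral => x _.
by rewrite EFinM abseM [X in _ * X]gee0_abs// lee_fin normal_pdf_ge0.
Qed.

Lemma integral_x_gaussian : \int[nu]_x x%:E = 0.
Proof.
rewrite integral_gaussian; last by apply/measurable_EFinP.
case: ifPn => // sn0; rewrite -(@integral_x_normal_pdf R s)//.
by rewrite lt_neqAle eq_sym sn0.
Qed.

Lemma integral_x2_gaussian : \int[nu]_x (x ^+ 2)%:E = (s ^+ 2)%:E.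
Proof.
rewrite integral_gaussian; last first.
  by apply/measurable_EFinP; exact: measurable_funX.
case: ifPn => [/eqP ->|sn0]; first by [].
by rewrite integral_x2_normal_pdf// lt_neqAle eq_sym sn0.
Qed.

End gaussian_law_moments.

(** * Second moments of sums of independent errors *)

Section uncorrelated.
Local Open Scope ereal_scope.
Context d d' (T : measurableType d) (T' : measurableType d') (R : realType).
Variable P : probability T R.

(** Domination by [f^2 + g^2], from [0 <= (|f| - |g|)^2]. *)
Lemma integrable_mul_square_integrable (f g : T -> R) :
    measurable_fun setT f -> measurable_fun setT g ->
    P.-integrable setT (fun w => (f w ^+ 2)%:E) ->
    P.-integrable setT (fun w => (g w ^+ 2)%:E) ->
  P.-integrable setT (fun w => (f w * g w)%:E).
Proof.
move=> mf mg intf intg.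
apply: le_integrable (integrableD measurableT intf intg) => //.
  by apply/measurable_EFinP; exact: measurable_funM.
move=> w _; rewrite -EFinD !abse_EFin lee_fin.
rewrite [leRHS]ger0_norm ?addr_ge0 ?sqr_ge0//.
rewrite -(real_normK (num_real (f w))) -(real_normK (num_real (g w))) normrM.
have := sqr_ge0 (`|f w| - `|g w|)%R.
by have := normr_ge0 (f w); have := normr_ge0 (g w); nra.
Qed.

(** Independence makes the law of [(X, Y)] the product of the marginal laws, since both agree on
    rectangles. By Fubini the inner integral in [y] is [f x] times the mean of [g (Y w)], which is
    0. *)
Lemma independent_integral_mul_eq0 (X Y : {mfun T >-> T'}) (f g : T' -> R) :
    (forall A B, measurable A -> measurable B ->
      P (X @^-1` A `&` Y @^-1` B) = P (X @^-1` A) * P (Y @^-1` B)) ->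
    measurable_fun setT f -> measurable_fun setT g ->
    P.-integrable setT (fun w => (f (X w) * g (Y w))%:E) ->
    P.-integrable setT (fun w => (g (Y w))%:E) ->
    \int[P]_w (g (Y w))%:E = 0 ->
  \int[P]_w (f (X w) * g (Y w))%:E = 0.
Proof.
move=> ind mf mg intfg intg g0.
pose XY w := (X w, Y w).
have mXY : measurable_fun setT XY by exact: measurable_fun_pair.
pose h (z : T' * T') := (f z.1 * g z.2)%:E.
have mh : measurable_fun setT h.
  apply/measurable_EFinP; apply: measurable_funM.
    exact: (measurableT_comp mf measurable_fst).
  exact: (measurableT_comp mg measurable_snd).
have E (A : set (T' * T')) : measurable A ->
    (distribution P X \x distribution P Y) A = pushforward P XY A.
  apply: product_measure_unique => A1 A2 mA1 mA2.
  by rewrite -ind.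
transitivity (\int[pushforward P XY]_z h z).
  by rewrite integral_pushforward.
have inth : (pushforward P XY).-integrable setT h by exact: integrable_pushforward.
rewrite (eq_measure_integral (distribution P X \x distribution P Y)); last first.
  by move=> A mA _; exact/esym/E.
rewrite -integral12_prod_meas1; last first.
  move/integrableP : inth => [_ inth]; apply/integrableP; split=> //.
  rewrite (eq_measure_integral (pushforward P XY))// => A mA _.
  exact: E.
rewrite integral0_eq// => x _; rewrite /fubini_F /h /=.
under eq_integral do rewrite EFinM.
rewrite integralZl//; last first.
  apply: integrable_pushforward => //.
  by apply/measurable_EFinP.
rewrite (_ : \int[_]_y _ = 0) ?mule0// -[RHS]g0.
by rewrite integral_pushforward//; exact/measurable_EFinP.
Qed.

End uncorrelated.

(** In the expanded square the off-diagonal terms integrate to 0, and each of the [m] diagonal ones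
    contributes at most [C]. *)
Lemma integral_sqr_sum_uncorrelated d (T : measurableType d) (R : realType)
    (P : probability T R) (Z : nat -> T -> R) (C : R) (m : nat) :
    (forall i, measurable_fun setT (Z i)) ->
    (forall i, P.-integrable setT (fun w => (Z i w ^+ 2)%:E)) ->
    (forall i j, i != j -> \int[P]_w (Z i w * Z j w)%:E = 0)%E ->
    (forall i, \int[P]_w (Z i w ^+ 2)%:E <= C%:E)%E ->
  (\int[P]_w ((\sum_(i < m) Z i w) ^+ 2)%:E <= (m%:R * C)%:E)%E.
Proof.
move=> mZ intZ Z0 ZC.
have intZZ i j : P.-integrable setT (fun w => (Z i w * Z j w)%:E).
  exact: integrable_mul_square_integrable.
have -> : (\int[P]_w ((\sum_(i < m) Z i w) ^+ 2)%:E =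
    \sum_(i < m) \sum_(j < m) \int[P]_w (Z i w * Z j w)%:E)%E.
  under eq_integral do rewrite expr2 big_distrlr/= -sumEFin.
  rewrite integral_sum//; last first.
    move=> i; under eq_fun do rewrite -sumEFin.
    by apply: integrable_sum.
  apply: eq_bigr => i _; under eq_integral do rewrite -sumEFin.
  by rewrite integral_sum.
apply: (@le_trans _ _ (\sum_(i < m) C%:E)%E); last first.
  by rewrite sumEFin sumr_const card_ord mulr_natl.
apply: lee_sum => i _; rewrite (bigD1 i)//= big1 => [|j ji].
  by rewrite adde0; under eq_integral do rewrite -expr2.
by rewrite Z0// eq_sym; move: ji.
Qed.

(** * Moments of the noise and of the errors of squared ranges *)

Section range_noise.
Context d (T : measurableType d) (R : realType) (P : probability T R).
Variables (r : nat -> {RV P >-> R}) (s : R).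
Hypotheses (s0 : 0 <= s) (hr : iid_gaussian r 0 s).

(* Lebesgue measure, hence the normal law, lives on [measurableTypeR R], whose
   display differs from the one of the codomain of a random variable. *)
Let mr i : measurable_fun [set: T] (r i : T -> measurableTypeR R).
Proof. exact: (@measurable_funPT _ _ _ _ (r i)). Qed.

Let X i : {mfun T >-> measurableTypeR R} :=
  HB.pack (r i : T -> measurableTypeR R) (isMeasurableFun.Build _ _ _ _ _ (mr i)).

Let XE i B : measurable B -> distribution P (X i) B = gaussian 0 s B.
Proof. exact: hr.2. Qed.

Let integrable_noise i k : (k <= 4)%N ->
  P.-integrable setT (fun w => (r i w ^+ k)%:E).
Proof.
move=> k4; apply/integrableP; split.
  by apply/measurable_EFinP; exact: measurable_funX.
have /integrableP[mk] := integrable_exprn_gaussian s0 (XE i) k4.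
by rewrite ge0_integral_distribution//; exact: measurableT_comp.
Qed.

Let integral_noise i : (\int[P]_w (r i w)%:E = 0)%E.
Proof.
rewrite -(integral_x_gaussian s0 (XE i)) integral_distribution//.
exact: (@integrable_noise i 1).
Qed.

Let integral_noise2 i : (\int[P]_w (r i w ^+ 2)%:E = (s ^+ 2)%:E)%E.
Proof.
rewrite -(integral_x2_gaussian s0 (XE i)) integral_distribution//.
  by apply/measurable_EFinP; exact: measurable_funX.
exact: (@integrable_noise i 2).
Qed.

Let integral_noise4 i :
  (\int[P]_w (r i w ^+ 4)%:E = \int[P]_w (r 0%N w ^+ 4)%:E)%E.
Proof.
have m4 : measurable_fun [set: measurableTypeR R] (fun x : R => (x ^+ 4)%:E).
  by apply/measurable_EFinP; exact: measurable_funX.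
transitivity (\int[distribution P (X i)]_x (x ^+ 4)%:E)%E.
  by rewrite integral_distribution//; exact: (@integrable_noise i 4).
transitivity (\int[distribution P (X 0%N)]_x (x ^+ 4)%:E)%E.
  by apply: eq_measure_integral => A mA _; exact: etrans (XE i mA) (esym (XE 0%N mA)).
by rewrite integral_distribution//; exact: (@integrable_noise 0%N 4).
Qed.

Let independent_noise i j : i != j -> forall A B : set (measurableTypeR R),
  measurable A -> measurable B ->
  P (X i @^-1` A `&` X j @^-1` B) = (P (X i @^-1` A) * P (X j @^-1` B))%E.
Proof.
move=> ij A B mA mB.
have := hr.1 [:: i; j] (fun k => if k == i then A else B).
rewrite /= inE ij => /(_ isT).
have mAB k : measurable (if k == i then A else B) by case: ifP.
move=> /(_ mAB); rewrite !big_cons big_nil mule1 eqxx eq_sym (negbTE ij) => <-.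
congr (P _); apply/seteqP; split=> [w [wA wB] k /=|w wAB].
  by rewrite !inE => /orP[] /eqP ->; rewrite ?eqxx// eq_sym (negbTE ij).
split; first by have := wAB i; rewrite /= !inE eqxx; exact.
by have := wAB j; rewrite /= !inE eqxx orbT eq_sym (negbTE ij); exact.
Qed.

(** This is [(rho + x)^2 - rho^2] minus its mean [s^2] under the noise law. *)
Definition sqr_range_error (rho x : R) : R := 2 * rho * x + x ^+ 2 - s ^+ 2.

Let integral_axpy (a : R) (f g : T -> R) :
    P.-integrable setT (fun w => (f w)%:E) ->
    P.-integrable setT (fun w => (g w)%:E) ->
  P.-integrable setT (fun w => (a * f w + g w)%:E) /\
  (\int[P]_w (a * f w + g w)%:E = a%:E * \int[P]_w (f w)%:E + \int[P]_w (g w)%:E)%E.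
Proof.
move=> intf intg; have intaf := integrableZl measurableT a intf.
under eq_fun do rewrite EFinD EFinM; split; first exact: integrableD.
by rewrite integralD// integralZl.
Qed.

Let integral_trinomial (a b c : R) i j k : (j <= 4)%N -> (k <= 4)%N ->
  P.-integrable setT (fun w => (a * r i w ^+ j + (b * r i w ^+ k + c))%:E) /\
  (\int[P]_w (a * r i w ^+ j + (b * r i w ^+ k + c))%:E =
   a%:E * \int[P]_w (r i w ^+ j)%:E + (b%:E * \int[P]_w (r i w ^+ k)%:E + c%:E))%E.
Proof.
move=> j4 k4.
have intc : P.-integrable setT (fun=> c%:E) by exact: finite_measure_integrable_cst.
have [intb intbE] := integral_axpy b (integrable_noise i k4) intc.
have [inta intaE] := integral_axpy a (integrable_noise i j4) intb.
split=> //; rewrite intaE intbE; congr (_ + (_ + _))%E.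
by rewrite integral_cst//= probability_setT mule1.
Qed.

(** The summands are centered and pairwise independent, hence uncorrelated, and their second moments
    are bounded through the second and fourth moments of the noise. The constant precedes [c], [rho]
    and [m], so it is uniform in them. *)
Lemma integral_sqr_sum_range_error (K D : R) : exists C : R,
  forall (c rho : nat -> R) (m : nat),
    (forall i, `|c i| <= K) -> (forall i, `|rho i| <= D) ->
  (\int[P]_w ((\sum_(i < m) c i * sqr_range_error (rho i) (r i w)) ^+ 2)%:E
    <= (m%:R * C)%:E)%E.
Proof.
pose M4 := fine (\int[P]_w (r 0%N w ^+ 4)%:E)%E.
(* Coefficients from [(u + v - w)^2 <= 3 (u^2 + v^2 + w^2)] with [u = 2 rho x], [v = x^2], [w = s^2]
   and [|rho| <= D]. *)
pose a2 := K ^+ 2 * (12 * D ^+ 2); pose a4 := K ^+ 2 * 3.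
pose a0 := a4 * s ^+ 4.
exists (a2 * s ^+ 2 + (a4 * M4 + a0)) => c rho m cK rhoD.
pose g i x := c i * sqr_range_error (rho i) x.
have mg i : measurable_fun [set: measurableTypeR R] (g i).
  apply: measurable_funM => //; apply: measurable_funB => //.
  apply: measurable_funD; first exact: measurable_funM.
  exact: measurable_funX.
have gE i w : g i (r i w) =
    2 * c i * rho i * r i w ^+ 1 + (c i * r i w ^+ 2 + - (c i * s ^+ 2)).
  by rewrite /g /sqr_range_error; ring.
have gb i w : g i (r i w) ^+ 2 <= a2 * r i w ^+ 2 + (a4 * r i w ^+ 4 + a0).
  have cK2 : c i ^+ 2 <= K ^+ 2.
    by rewrite -[leLHS]real_normK ?num_real// ler_pXn2r ?nnegrE ?(le_trans _ (cK i)).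
  have rD2 : rho i ^+ 2 <= D ^+ 2.
    by rewrite -[leLHS]real_normK ?num_real// ler_pXn2r ?nnegrE ?(le_trans _ (rhoD i)).
  have -> : a2 * r i w ^+ 2 + (a4 * r i w ^+ 4 + a0) =
    K ^+ 2 * (3 * (4 * D ^+ 2 * r i w ^+ 2 + r i w ^+ 4 + s ^+ 4)).
    by rewrite /a0 /a2 /a4; ring.
  rewrite /g exprMn ler_pM ?sqr_ge0// /sqr_range_error.
  apply: (@le_trans _ _ (3 * (4 * rho i ^+ 2 * r i w ^+ 2 + r i w ^+ 4 + s ^+ 4))).
    (* The difference of the two sides is the sum of these three squares. *)
    have := sqr_ge0 (2 * rho i * r i w - r i w ^+ 2).
    have := sqr_ge0 (2 * rho i * r i w + s ^+ 2).
    have := sqr_ge0 (r i w ^+ 2 + s ^+ 2).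
    by nra.
  by rewrite ler_wpM2l// !lerD2r ler_wpM2r ?sqr_ge0// ler_wpM2l.
have intb i := integral_trinomial a2 a4 a0 i (isT : 2 <= 4)%N (isT : 4 <= 4)%N.
have intg2 i : P.-integrable setT (fun w => (g i (r i w) ^+ 2)%:E).
  apply: le_integrable (intb i).1 => //.
    by apply/measurable_EFinP/measurable_funX; exact: (measurableT_comp (mg i)).
  move=> w _; rewrite !abse_EFin lee_fin ger0_norm ?sqr_ge0//.
  by rewrite (le_trans (gb i w))// ler_norm.
have [intg g0] : (forall i, P.-integrable setT (fun w => (g i (r i w))%:E)) /\
    (forall i, (\int[P]_w (g i (r i w))%:E = 0)%E).
  split=> i; have [intgi gi0] := integral_trinomial (2 * c i * rho i) (c i)
    (- (c i * s ^+ 2)) i (isT : 1 <= 4)%N (isT : 2 <= 4)%N.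
    by under eq_fun do rewrite gE.
  under eq_integral do rewrite gE.
  by rewrite gi0 integral_noise mule0 add0e integral_noise2 -EFinM -EFinD subrr.
apply: (@integral_sqr_sum_uncorrelated _ _ _ _ (fun i w => g i (r i w))) => //.
- by move=> i; exact: (measurableT_comp (mg i)).
- move=> i j ij.
  apply: (@independent_integral_mul_eq0 _ _ _ _ _ P (X i) (X j) (g i) (g j)) => //.
  + exact: independent_noise.
  + apply: integrable_mul_square_integrable => //.
    * exact: (measurableT_comp (mg i)).
    * exact: (measurableT_comp (mg j)).
- move=> i; have [intbi intbE] := intb i.
  rewrite (le_trans (_ : _ <= \int[P]_w (a2 * r i w ^+ 2 + (a4 * r i w ^+ 4 + a0))%:E)%E)//.
    apply: le_integral => // w _; rewrite lee_fin; exact: gb.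
  rewrite intbE integral_noise2 integral_noise4 /M4 !EFinD !EFinM fineK//.
  exact: integrable_fin_num (integrable_noise 0 (isT : 4 <= 4)%N).
Qed.

End range_noise.

(** * Frequencies of boxes under weak convergence *)

Section borel_vectors.
Context (R : realType) (n : nat).
Implicit Types (z p q : 'cV[R]_n) (k : 'I_n) (A : set 'cV[R]_n).

Lemma open_borel_vec A : open A -> measurable (A : set (borel_vec R n)).
Proof. exact: sub_sigma_algebra. Qed.

Lemma measurable_coord k :
  measurable_fun [set: borel_vec R n] (fun x : borel_vec R n => (x : 'cV[R]_n) k 0).
Proof.
apply: (measurability _ (RGenOInfty.measurableE R)) => _ [_ [r ->] <-].
rewrite setTI; apply: open_borel_vec.
apply: open_comp; first by move=> x _; exact: coord_continuous.
exact: interval_open.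
Qed.

Definition coord_mfun k : {mfun borel_vec R n >-> R} :=
  HB.pack (fun x : borel_vec R n => (x : 'cV[R]_n) k 0)
    (isMeasurableFun.Build _ _ _ _ _ (measurable_coord k)).

Lemma measurable_vle z : measurable ([set x | vle x z] : set (borel_vec R n)).
Proof.
rewrite (_ : [set x | _] = \bigcap_(k in setT) (coord_mfun k @^-1` `]-oo, z k 0])).
  apply: fin_bigcap_measurable => // k _.
  by rewrite -[X in measurable X]setTI; exact: measurable_coord.
apply/seteqP; split=> x /=.
  by move=> /forallP xz k _ /=; rewrite in_itv/= xz.
by move=> xz; apply/forallP => k; have /= := xz k I; rewrite in_itv.
Qed.

Section atoms.
Variable mu : probability (borel_vec R n) R.

(** A coordinatewise condition that implies continuity of [df mu] at [z] and survives mixing the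
    coordinates of two such corners, as [clip] does. *)
Definition continuity_corner z :=
  forall k, mu [set x : borel_vec R n | coord_mfun k x = z k 0] = 0%E.

Let strip z (e : R) : set (borel_vec R n) :=
  \bigcup_(k in setT) [set x | `|coord_mfun k x - z k 0| <= e].

Let measurable_strip z e : measurable (strip z e).
Proof.
apply: fin_bigcup_measurable => // k _.
rewrite (_ : [set x | _] = coord_mfun k @^-1` `[z k 0 - e, z k 0 + e]).
  by rewrite -[X in measurable X]setTI; exact: measurable_coord.
by apply/seteqP; split=> x /=; rewrite in_itv/= ler_distl.
Qed.

(** The strips decrease to the union of the null hyperplanes [x_k = z_k]; continuity from above
    applies. *)
Let strip_small z (e : R) : continuity_corner z -> 0 < e ->
  exists2 d : R, 0 < d & (mu (strip z d) < e%:E)%E.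
Proof.
move=> zc e0.
have mcap : measurable (\bigcap_j strip z j.+1%:R^-1).
  by apply: bigcap_measurableType => j _; exact: measurable_strip.
have strip0 : mu (\bigcap_j strip z j.+1%:R^-1) = 0%E.
  apply/eqP; rewrite -measure_le0.
  pose N k := [set x : borel_vec R n | coord_mfun k x = z k 0].
  have mN k : measurable (N k).
    rewrite -[N k]/(coord_mfun k @^-1` [set z k 0]) -[X in measurable X]setTI.
    exact: measurable_coord.
  have sub : \bigcap_j strip z j.+1%:R^-1 `<=` \bigcup_(k in setT) N k.
    move=> x xs; apply: contrapT => xN.
    have dpos k : exists j, j.+1%:R^-1 < `|coord_mfun k x - z k 0|.
      have d0 : 0 < `|coord_mfun k x - z k 0|.
        by rewrite normr_gt0 subr_eq0; apply/eqP => xz; apply: xN; exists k.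
      have d1 : 0 < `|coord_mfun k x - z k 0|^-1 by rewrite invr_gt0.
      exists (Num.bound `|coord_mfun k x - z k 0|^-1).
      rewrite invf_plt ?posrE ?ltr0n//.
      by rewrite (lt_trans (archi_boundP (ltW d1)))// ltr_nat.
    (* Off the hyperplanes each coordinate leaves its slab at some index; the largest of these
       finitely many indices serves them all. *)
    have [j jk] := fin_all_exists dpos.
    have [k _ /=] := xs (\max_(k < n) j k)%N I.
    apply/negP; rewrite -ltNge; apply: le_lt_trans (jk k).
    by rewrite lef_pV2 ?posrE ?ltr0n// ler_nat ltnS leq_bigmax.
  have fI : finite_set [set: 'I_n] by [].
  rewrite (le_trans (content_sub_fsum mu fI (fun k _ => mN k) mcap sub))//.
  by rewrite fsbig1// => k _; exact: zc.
have : (mu \o (fun j => strip z j.+1%:R^-1)) @ \oo --> 0%E.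
  rewrite -strip0; apply: nonincreasing_cvg_mu.
  - by rewrite (le_lt_trans (probability_le1 _ _))// ?ltry.
  - by move=> j; exact: measurable_strip.
  - exact: mcap.
  - move=> i j ij; apply/subsetPset => x [k _ /= xk]; exists k => //=.
    by rewrite (le_trans xk)// lef_pV2 ?posrE ?ltr0n// ler_nat ltnS.
move=> /(_ _ (open_nbhs_nbhs (conj (@open_ereal_lt_ereal R e%:E) _))).
move=> /(_ _) [|j _ /(_ j (leqnn j)) /= sj]; first by rewrite /= lte_fin.
by exists j.+1%:R^-1; rewrite ?invr_gt0 ?ltr0n.
Qed.

(** For corners within [d] of [z], the lower orthants differ only inside the strip of half-width
    [d]. *)
Lemma df_continuous z : continuity_corner z -> {for z, continuous (df mu)}.
Proof.
move=> zc; apply: (iffRL (@cvgrPdist_lt _ R^o _ (nbhs z) _ (df mu) (df mu z))) => e e0.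
have [d d0 sd] := strip_small zc e0.
(* Symmetric in the two points near [z], so that it yields both signs of the difference. *)
have dfD (x y : 'cV[R]_n) :
    (forall k, `|z k 0 - x k 0| <= d) -> (forall k, `|z k 0 - y k 0| <= d) ->
    df mu x - df mu y < e.
  move=> zx zy; rewrite ltrBlDl /df -lte_fin EFinD.
  rewrite !fineK ?fin_num_measure//; try exact: measurable_vle.
  have sub : [set w | vle w x] `<=` [set w | vle w y] `|` strip z d.
    move=> w /= /forallP wx; have [wy|] := boolP (vle w y); first by left.
    rewrite negb_forall => /existsP[k]; rewrite -ltNge => ywk; right.
    exists k => //=; rewrite ler_distlC; have := wx k; have := zx k; have := zy k.
    by rewrite !ler_distl => /andP[? ?] /andP[? ?] ?; apply/andP; split; lra.
  apply: (@le_lt_trans _ _ (mu ([set w | vle w y] `|` strip z d))).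
    apply: le_measure; rewrite ?inE//; first exact: measurable_vle.
    by apply: measurableU; [exact: measurable_vle|exact: measurable_strip].
  apply: le_lt_trans (measureU2 _ (measurable_vle y) (measurable_strip z d)) _.
  rewrite lteD2lE// fin_num_measure//; exact: measurable_vle.
have zz k : `|z k 0 - z k 0| <= d by rewrite subrr normr0 ltW.
have : \forall y \near z, ball z d y by exact: nbhsx_ballx.
apply: filterS => y [_ zdy].
have zy k : `|z k 0 - y k 0| <= d by rewrite ltW//; have := zdy k 0.
by rewrite ltr_norml ltrNl opprB !dfD.
Qed.

End atoms.

End borel_vectors.

(** * Boxes with good corners and the fraction of sensors in them *)

Section boxes.
Context (R : realType) (n : nat).
Variables (mu : probability (borel_vec R n) R) (a : nat -> 'cV[R]_n).
Implicit Types (p q : 'cV[R]_n) (k : 'I_n).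

(** Each coordinate has countably many atoms, so their rational translates form a Lebesgue-null set.
    A [t] outside it gives a countable dense grid of good corners. *)
Lemma continuity_grid : exists t : R, forall v : 'cV[rat]_n,
  continuity_corner mu (\col_k (t + ratr (v k 0))).
Proof.
pose bad := \bigcup_(k in [set: 'I_n]) \bigcup_(q in [set: rat])
  ((fun r : R => r - ratr q) @` [set r | 0 < pmf (coord_mfun R k : {RV mu >-> R}) r]).
have cbad : countable bad.
  apply: bigcup_countable => [|k _]; first exact: countableP.
  apply: bigcup_countable => [|q _]; first exact: countableP.
  exact: sub_countable (card_image_le _ _) (pmf_gt0_countable _).
have [t tbad] : exists t, ~ bad t.
  apply: contrapT => /forallNP all_bad.
  have badT : bad = setT by apply/seteqP; split=> // t _; apply: contrapT; exact: all_bad.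
  have := countable_lebesgue_measure0 cbad.
  by rewrite badT -set_itvNyy lebesgue_measure_itv.
exists t => v k; rewrite mxE; apply: contrapT => /eqP mk0; apply: tbad.
exists k => //; exists (v k 0) => //; exists (t + ratr (v k 0)); last by rewrite addrK.
rewrite /= /pmf fine_gt0// lt0e mk0 measure_ge0/=.
have mk : measurable (coord_mfun R k @^-1` [set t + ratr (v k 0)]).
  by rewrite -[X in measurable X]setTI; exact: measurable_coord.
by rewrite (le_lt_trans (probability_le1 _ mk)) ?ltry.
Qed.

Definition frequency (A : set 'cV[R]_n) (m : nat) : R :=
  (\sum_(i < m) \1_A (a i)) / m%:R.

(** Only the coordinates listed in [s] are bounded below, which permits induction from an orthant
    ([s = [::]]) to a half-open box ([s = enum 'I_n]). *)
Definition box (s : seq 'I_n) p q : set 'cV[R]_n :=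
  [set x | vle x q /\ forall k, k \in s -> p k 0 < x k 0].

(** The minimum keeps the result below [q] even when [q_k < p_k], whence [box_clip_sub]. *)
Definition clip p q k : 'cV[R]_n :=
  \col_j (if j == k then Num.min (p j 0) (q j 0) else q j 0).

(** Requiring [p_k < x_k] removes exactly the points with [x_k <= p_k]: one step of
    inclusion-exclusion over the corners. *)
Lemma box_cons k s p q : box (k :: s) p q = box s p q `\` box s p (clip p q k).
Proof.
apply/seteqP; split=> x [].
  move=> xq xp; split; first by split=> // j js; rewrite xp// inE js orbT.
  move=> [/forallP/(_ k)]; rewrite mxE eqxx le_min => /andP[xk _] _.
  by have := xp k (mem_head _ _); rewrite ltNge xk.
move=> [/forallP xq xp] nx; split; first exact/forallP.
move=> j; rewrite inE => /orP[/eqP ->|]; last exact: xp.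
rewrite ltNge; apply/negP => xk; apply: nx; split=> //.
apply/forallP => i; rewrite mxE; case: eqP => // ->.
by rewrite le_min xk xq.
Qed.

Lemma box_clip_sub k s p q : box s p (clip p q k) `<=` box s p q.
Proof.
move=> x [/forallP xq xp]; split=> //; apply/forallP => j.
have := xq j; rewrite mxE; case: ifP => // _.
by rewrite le_min => /andP[].
Qed.

Lemma measurable_box s p q : measurable (box s p q : set (borel_vec R n)).
Proof.
elim: s q => [|k s ih] q; last by rewrite box_cons; apply: measurableD; exact: ih.
rewrite (_ : box _ _ _ = [set x | vle x q]); first exact: measurable_vle.
by apply/seteqP; split=> x // [].
Qed.

Hypothesis sample_cvg : forall z : 'cV[R]_n, {for z, continuous (df mu)} ->
  sample_df a m z @[m --> \oo] --> df mu z.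

(** Induction on [s]. For an orthant this is the convergence of distribution functions at the
    continuity point [q]; in the step, frequency and measure are both subtractive on the nested
    boxes of [box_cons]. *)
Lemma frequency_box_cvg s p q : continuity_corner mu p -> continuity_corner mu q ->
  frequency (box s p q) m @[m --> \oo] --> fine (mu (box s p q)).
Proof.
move=> cp; elim: s q => [|k s ih] q cq.
  have -> : box [::] p q = [set x | vle x q] by apply/seteqP; split=> x // [].
  have fE m : frequency [set x | vle x q] m = sample_df a m q.
    rewrite /sample_df /frequency.
    congr (_ / _); rewrite -sum1_card natr_sum [RHS]big_mkcond/=.
    apply: eq_bigr => i _; rewrite indicE.
    have [az|/negP az] := boolP (vle (a i) q); first by rewrite !mem_set.
    by rewrite !memNset.
  by under eq_fun do rewrite fE; exact: sample_cvg (df_continuous cq).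
have cc : continuity_corner mu (clip p q k).
  move=> j; rewrite mxE; case: ifP => // _.
  by rewrite /Num.min; case: ifP => _; [exact: cp|exact: cq].
have fB m : frequency (box (k :: s) p q) m =
    frequency (box s p q) m - frequency (box s p (clip p q k)) m.
  rewrite /frequency -mulrBl -sumrB; congr (_ / _); apply: eq_bigr => i _.
  rewrite !indicE box_cons in_setD.
  have [aic|_] := boolP (a i \in box s p (clip p q k)); last by rewrite subr0 andbT.
  by rewrite andbF mem_set ?subrr//; apply: (@box_clip_sub k); exact: set_mem.
under eq_fun do rewrite fB.
have fin_box : (mu (box s p q) < +oo)%E.
  by rewrite (le_lt_trans (probability_le1 _ (measurable_box s p q))) ?ltry.
rewrite box_cons (measureD (measurable_box s p q) (measurable_box s p _) fin_box).
rewrite (setIidr (@box_clip_sub _ _ _ _)).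
rewrite fineB ?fin_num_measure//; try exact: measurable_box.
by apply: (@cvgB _ R^o); exact: ih.
Qed.

End boxes.

(** * Uniform lower bound for the Gram matrix *)

Lemma ler_mx_norm (R : realDomainType) (m n : nat) (A : 'M[R]_(m, n)) i j :
  `|A i j| <= mx_norm A.
Proof. by rewrite mx_normrE (le_bigmax _ (fun ij => `|A ij.1 ij.2|) (i, j)). Qed.

Section affine_form.
Context (R : realType) (n : nat).
Implicit Types (u : 'rV[R]_(n + 1)) (x y : 'cV[R]_n).

(** The entry of [nel_A a m *m u^T] contributed by a sensor at [x]; its squares sum to the Gram
    quadratic form ([gram_quadE]). *)
Definition affine_form u x : R := (row_mx ((- 2) *: x^T) 1%:M *m u^T) 0 0.

Lemma affine_formE u x : affine_form u x =
  \sum_(k < n) (- 2 * x k 0 * u 0 (lshift 1 k)) + u 0 (rshift n 0).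
Proof.
rewrite /affine_form mxE big_split_ord/=; congr (_ + _).
  by apply: eq_bigr => k _; rewrite row_mxEl !mxE.
by rewrite big_ord_recl big_ord0 addr0 row_mxEr !mxE mul1r.
Qed.

Lemma affine_formB u v x : affine_form (u - v) x = affine_form u x - affine_form v x.
Proof. by rewrite /affine_form raddfB mulmxBr !mxE. Qed.

Lemma affine_formZ c u x : affine_form (c *: u) x = c * affine_form u x.
Proof. by rewrite /affine_form linearZ -scalemxAr !mxE. Qed.

Lemma ler_norm_affine_form (M : R) u x : (forall k, `|x k 0| <= M) ->
  `|affine_form u x| <= (2 * n%:R * M + 1) * `|u|.
Proof.
move=> xM; rewrite affine_formE mulrDl mul1r.
rewrite (le_trans (ler_normD _ _))// lerD ?ler_mx_norm//.
rewrite (le_trans (ler_norm_sum _ _ _))//.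
apply: (@le_trans _ _ (\sum_(k < n) 2 * M * `|u|)); last first.
  rewrite sumr_const card_ord -[leLHS]mulr_natl le_eqVlt.
  by apply/orP; left; apply/eqP; ring.
apply: ler_sum => k _; rewrite !normrM normrN (@ger0_norm _ 2)//.
by rewrite ler_pM ?mulr_ge0 ?ler_mx_norm// ler_wpM2l.
Qed.

Lemma ler_dist_affine_form u x y (d : R) : (forall k, `|x k 0 - y k 0| <= d) ->
  `|affine_form u x - affine_form u y| <= 2 * n%:R * `|u| * d.
Proof.
move=> xyd; rewrite !affine_formE [X in _ - X]addrC addrKA -sumrB.
rewrite (le_trans (ler_norm_sum _ _ _))//.
apply: (@le_trans _ _ (\sum_(k < n) 2 * d * `|u|)); last first.
  rewrite sumr_const card_ord -[leLHS]mulr_natl le_eqVlt.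
  by apply/orP; left; apply/eqP; ring.
apply: ler_sum => k _.
rewrite -mulrBl -mulrBr !normrM normrN (@ger0_norm _ 2)//.
by rewrite ler_pM ?mulr_ge0 ?ler_mx_norm// ler_wpM2l.
Qed.

Lemma measurable_affine_form u :
  measurable ([set x | affine_form u x != 0] : set (borel_vec R n)).
Proof.
apply: open_borel_vec; rewrite openE => x /= ux0.
have N0 : 0 < 2 * n%:R * `|u| + 1 by rewrite ltr_pwDr// !mulr_ge0.
(* The [+ 1] makes the Lipschitz estimate strict, so the form cannot vanish within distance [d] of
   [x]: the set is open. *)
pose d := `|affine_form u x| / (2 * n%:R * `|u| + 1).
have d0 : 0 < d by rewrite divr_gt0// normr_gt0.
have : \forall y \near x, ball x d y by exact: nbhsx_ballx.
apply: filterS => y [_ xyd]; apply/negP => /eqP uy0.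
have := @ler_dist_affine_form u x y d (fun k => ltW (xyd k 0)).
rewrite uy0 subr0 leNgt => /negP; apply.
by rewrite /d mulrA ltr_pdivrMr// [ltRHS]mulrC ltr_pM2r ?normr_gt0// ltrDl.
Qed.

(** The zero set is a translate of the orthogonal complement of the linear part [w], and [p] is the
    multiple of [w] lying on it. *)
Lemma affine_hyperplane u : (exists k, u 0 (lshift 1 k) != 0) ->
  affine_subspace n.-1 [set x | affine_form u x = 0].
Proof.
move=> [k0 uk0]; pose w : 'M[R]_(n, 1) := \col_k u 0 (lshift 1 k).
have w0 : w != 0.
  by apply: contraNneq uk0 => /matrixP/(_ k0 0); rewrite !mxE => ->.
have rw : \rank (kermx w) = n.-1.
  by rewrite mxrank_ker (_ : \rank w = 1%N) ?subn1//; rewrite -mxrank_tr rank_rV trmx_eq0 w0.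
have formE x : affine_form u x = - 2 * (x^T *m w) 0 0 + u 0 (rshift n 0).
  rewrite affine_formE mxE mulr_sumr; congr (_ + _); apply: eq_bigr => k _.
  by rewrite !mxE mulrA.
pose p : 'cV[R]_n := (u 0 (rshift n 0) / (2 * (w^T *m w) 0 0)) *: w.
(* Writing the dimension as the rank of the kernel gives the basis matrix the required type. *)
rewrite -rw; exists p, (row_base (kermx w))^T; split.
  by rewrite mxrank_tr eq_row_base.
have ww0 : (w^T *m w) 0 0 != 0.
  rewrite mxE psumr_eq0 => [|i _]; last by rewrite mxE -expr2 sqr_ge0.
  apply/allPn; exists k0; first by rewrite mem_index_enum.
  by rewrite !mxE mulf_neq0.
have formp : affine_form u p = 0.
  rewrite formE /p linearZ -scalemxAl mxE; move: ww0; set q := (w^T *m w) 0 0 => q0.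
  by field.
have formB x : affine_form u x = - 2 * ((x - p)^T *m w) 0 0.
  have -> : ((x - p)^T *m w) 0 0 = (x^T *m w) 0 0 - (p^T *m w) 0 0.
    by rewrite raddfB mulmxBl [LHS]mxE [X in _ + X]mxE.
  by move: formp; rewrite !formE; lra.
apply/seteqP; split=> x /=.
  rewrite formB => /eqP; rewrite mulf_eq0 oppr_eq0 pnatr_eq0/= => /eqP xp0.
  have : ((x - p)^T <= row_base (kermx w))%MS.
    rewrite eq_row_base; apply/sub_kermxP/matrixP => i j.
    by rewrite !ord1 xp0 mxE.
  move=> /submxP[D xpE]; exists D^T => //.
  by rewrite -trmx_mul -xpE trmxK addrC subrK.
move=> [t _ <-]; rewrite formB addrAC subrr add0r trmx_mul trmxK -mulmxA.
have /sub_kermxP -> : (row_base (kermx w) <= kermx w)%MS by rewrite eq_row_base.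
by rewrite mulmx0 mxE mulr0.
Qed.

End affine_form.

(** * From charged boxes to a bound uniform in the direction *)

Section uniform_lower_bound.
Context (R : realType) (n : nat).
Variables (mu : probability (borel_vec R n) R) (a : nat -> 'cV[R]_n) (M : R).
Hypothesis aM : forall i k, `|a i k 0| <= M.
Hypothesis sample_cvg : forall z : 'cV[R]_n, {for z, continuous (df mu)} ->
  sample_df a m z @[m --> \oo] --> df mu z.
Implicit Types (u : 'rV[R]_(n + 1)) (p q : 'cV[R]_n).

(** The set where the form is nonzero is covered by countably many grid boxes on each of which its
    absolute value exceeds some [1/(j+1)]. If all of these were null, so would be the set. *)
Lemma charged_box u : mu [set x | affine_form u x != 0] != 0%E ->
  exists p q, [/\ continuity_corner mu p, continuity_corner mu q,
    0 < fine (mu (box (enum 'I_n) p q)) &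
    exists2 kappa : R, 0 < kappa &
      box (enum 'I_n) p q `<=` [set x | kappa < `|affine_form u x|]].
Proof.
move=> mu0; apply: contrapT => no_box.
have [t tgrid] := continuity_grid mu.
pose g (v : 'cV[rat]_n) : 'cV[R]_n := \col_k (t + ratr (v k 0)).
pose B (i : 'cV[rat]_n * 'cV[rat]_n) := box (enum 'I_n) (g i.1) (g i.2).
pose U j := [set x | j.+1%:R^-1 < `|affine_form u x|].
(* Enumeration of the boxes with their thresholds; codes of no admissible box give the empty set. *)
pose F i : set (borel_vec R n) :=
  if unpickle i is Some (vw, j) then
    if `[< B vw `<=` U j >] then B vw else set0 else set0.
have F0 i : mu.-negligible (F i).
  rewrite /F; case: unpickle => [[vw j]|]; last exact: negligible_set0.
  case: asboolP => [BU|_]; last exact: negligible_set0.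
  apply/negligibleP; first exact: measurable_box.
  apply/eqP; rewrite eq_le measure_ge0 andbT leNgt; apply/negP => muB.
  apply: no_box; exists (g vw.1), (g vw.2); split; [exact: tgrid|exact: tgrid| |].
    rewrite fine_gt0// muB/=.
    by rewrite (le_lt_trans (probability_le1 _ (measurable_box _ _ _))) ?ltry.
  by exists j.+1%:R^-1 => //; rewrite invr_gt0 ltr0n.
move/eqP: mu0; apply; apply/negligibleP; first exact: measurable_affine_form.
apply: negligibleS (negligible_bigcup F0) => x /= ux0.
have u0 : 0 < `|affine_form u x|^-1 by rewrite invr_gt0 normr_gt0.
pose j := Num.bound `|affine_form u x|^-1.
have jlt : j.+1%:R^-1 < `|affine_form u x|.
  rewrite invf_plt ?posrE ?ltr0n ?normr_gt0//.
  by rewrite (lt_trans (archi_boundP (ltW u0)))// ltr_nat.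
have N0 : 0 < 2 * n%:R * `|u| + 1 by rewrite ltr_pwDr// !mulr_ge0.
(* A move by at most [d] in each coordinate lowers the absolute value of the form by less than its
   excess over [1/(j+1)]. The grid corners are then chosen within [d] of [x], strictly on either
   side. *)
pose d := (`|affine_form u x| - j.+1%:R^-1) / (2 * n%:R * `|u| + 1).
have d0 : 0 < d by rewrite divr_gt0// subr_gt0.
have /fin_all_exists[v vP] k : exists v : rat, x k 0 - d - t < ratr v < x k 0 - t.
  have /rat_in_itvoo[v] : x k 0 - d - t < x k 0 - t by rewrite ltrD2r gtrBl.
  by rewrite in_itv/=; exists v.
have /fin_all_exists[w wP] k : exists w : rat, x k 0 - t < ratr w < x k 0 + d - t.
  have /rat_in_itvoo[w] : x k 0 - t < x k 0 + d - t by rewrite ltrD2r ltrDl.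
  by rewrite in_itv/=; exists w.
exists (pickle ((\col_k v k, \col_k w k), j)) => //.
rewrite /F pickleK; case: asboolP => [_|].
  split=> [|k _]; first apply/forallP => k.
    by rewrite !mxE; have /andP[+ _] := wP k; rewrite ltrBlDl => /ltW.
  by rewrite !mxE; have /andP[_] := vP k; rewrite ltrBrDl.
case=> y [/= /forallP yw vy].
have xyd k : `|x k 0 - y k 0| <= d.
  have := yw k; have := vy k; rewrite mem_enum => /(_ isT).
  have := vP k; have := wP k; rewrite !mxE ler_norml.
  by move=> /andP[? ?] /andP[? ?] ? ?; apply/andP; split; lra.
have := @ler_dist_affine_form _ _ u x y d xyd.
have dlt : 2 * n%:R * `|u| * d < `|affine_form u x| - j.+1%:R^-1.
  by rewrite /d mulrA ltr_pdivrMr// [ltRHS]mulrC ltr_pM2r ?subr_gt0// ltrDl.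
have := lerB_dist (affine_form u x) (affine_form u y).
move=> fB fd; rewrite /U /=.
by have := le_lt_trans (le_trans fB fd) dlt; rewrite ltrD2l ltrN2.
Qed.

Local Notation quad u m := (\sum_(i < m) affine_form u (a i) ^+ 2).

(** A charged box for a unit vector [u] still has the form above [kappa / 2] for nearby [v], and
    eventually holds more than [beta / 2] of the sensors. Compactness of the sphere makes constant
    and threshold uniform; homogeneity covers the other vectors. *)
Lemma quad_lower_bound :
    (forall u, u != 0 -> mu [set x | affine_form u x != 0] != 0%E) ->
  exists2 c : R, 0 < c & exists m0 : nat, forall m u, (m0 <= m)%N ->
    c * m%:R * `|u| ^+ 2 <= quad u m.
Proof.
move=> nondeg.
pose S : set 'rV[R]_(n + 1) := [set u | `|u| = 1].
have cS : compact S.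
  apply: bounded_closed_compact.
    by exists 1; split=> // r r1 u /= ->; exact: ltW.
  apply: (@closed_comp _ _ (fun u : 'rV[R]_(n + 1) => `|u|) [set 1]).
    by move=> u _; exact: norm_continuous.
  exact: closed_eq.
(* A single index is both the threshold on [m] and, inverted, the constant. [Q] weakens as [j]
   grows, which suits the near-covering form of compactness. *)
pose Q (j : nat) u := forall m, (j <= m)%N -> j.+1%:R^-1 * m%:R <= quad u m.
have /(iffLR (compact_near_coveringP _)) := cS.
move=> /(_ nat \oo Q eventually_filter) [u /= u1|j _ /(_ j (leqnn j)) Qj].
  have /charged_box[p [q [cp cq muB [kappa kappa0 BU]]]] :
      mu [set x | affine_form u x != 0] != 0%E.
    by apply: nondeg; rewrite -normr_eq0 u1 oner_eq0.
  set B := box _ _ _ in muB BU; set beta := fine _ in muB.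
  pose L := 2 * n%:R * `|M| + 1.
  have L0 : 0 < L by rewrite ltr_pwDr// !mulr_ge0.
  have [m1 _ freqB] : \forall m \near \oo, beta / 2 < frequency a B m.
    apply: (cvgr_gt _ (frequency_box_cvg sample_cvg cp cq)).
    by rewrite ltr_pdivrMr// ltr_pMr// ltr1n.
  pose c := beta / 2 * (kappa / 2) ^+ 2.
  have c0 : 0 < c by rewrite mulr_gt0 ?exprn_gt0 ?divr_gt0.
  (* [L] is the Lipschitz constant of the form in [u], so this radius costs at most [kappa / 2]; the
     two summands secure the frequency bound and [1/(j+1) <= c]. *)
  exists (ball u (kappa / (2 * L)), [set j | (m1 + Num.bound c^-1 <= j)%N]).
    split; first by apply: nbhsx_ballx; rewrite divr_gt0 ?mulr_gt0.
    by exists (m1 + Num.bound c^-1)%N.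
  move=> [v j] [/= uv mj] m jm.
  have jc : j.+1%:R^-1 <= c.
    rewrite invf_ple ?posrE ?ltr0n//.
    have cpos : 0 <= c^-1 by rewrite invr_ge0 ltW.
    rewrite (le_trans (ltW (archi_boundP cpos)))// ler_nat.
    by rewrite (leq_trans _ (leqnSn _))// (leq_trans (leq_addl _ _) mj).
  have mm1 : (m1 <= m)%N.
    by rewrite (leq_trans _ jm)// (leq_trans (leq_addr _ _) mj).
  rewrite (le_trans (ler_wpM2r _ jc))//.
  apply: (@le_trans _ _ (\sum_(i < m) \1_B (a i) * (kappa / 2) ^+ 2)).
    rewrite -mulr_suml /c mulrAC ler_wpM2r ?exprn_ge0 ?divr_ge0 ?(ltW kappa0)//.
    have [->|m0] := posnP m; first by rewrite mulr0 big_ord0.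
    by rewrite -ler_pdivlMr ?ltr0n// ltW// freqB.
  apply: ler_sum => i _; rewrite indicE.
  have [/set_mem aB|_] := boolP (a i \in B); last by rewrite mul0r sqr_ge0.
  rewrite mul1r -[leRHS]real_normK ?num_real// ler_pXn2r ?nnegrE ?divr_ge0 ?(ltW kappa0)//.
  have := BU _ aB => /= kf.
  have aM' k : `|a i k 0| <= `|M| by rewrite (le_trans (aM i k))// ler_norm.
  have := ler_norm_affine_form (u - v) aM'; rewrite affine_formB -/L.
  have uvd : L * `|u - v| < kappa / 2.
    move: uv; rewrite -ball_normE /= ltr_pdivlMr ?mulr_gt0//.
    by rewrite ltr_pdivlMr// => uv; rewrite -mulrA mulrC -mulrA.
  move=> fd; have fB := lerB_dist (affine_form u (a i)) (affine_form v (a i)).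
  have {}fB := le_trans fB fd.
  by lra.
exists j.+1%:R^-1; first by rewrite invr_gt0 ltr0n.
exists j => m u jm; have [->|u0] := eqVneq u 0.
  by rewrite normr0 expr0n/= mulr0 sumr_ge0// => i _; exact: sqr_ge0.
have := Qj (`|u|^-1 *: u); rewrite /S/= normrZ normfV normr_id mulVf ?normr_eq0//.
move=> /(_ erefl m jm).
under [X in _ <= X -> _]eq_bigr do rewrite affine_formZ exprMn.
rewrite -mulr_sumr exprVn [leRHS]mulrC ler_pdivlMr//.
by rewrite exprn_gt0// normr_gt0.
Qed.

End uniform_lower_bound.

(** * Consistency of the estimator *)

Section normal_equations.
Context (R : realType) (n : nat).
Variables (a : nat -> 'cV[R]_n) (m : nat).
Implicit Types (u : 'rV[R]_(n + 1)) (y : 'cV[R]_(n + 1)).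

Let A := nel_A a m.
Local Notation quad u := (\sum_(i < m) affine_form u (a i) ^+ 2).

Lemma nel_A_mulE y i : (A *m y) i 0 = affine_form y^T (a i).
Proof.
by rewrite /affine_form trmxK !mxE; apply: eq_bigr => j _; rewrite mxE.
Qed.

Lemma gram_quadE u : (u *m (A^T *m A) *m u^T) 0 0 = quad u.
Proof.
rewrite mulmxA -(trmxK (u *m A^T)) trmx_mul trmxK -mulmxA mxE.
by apply: eq_bigr => i _; rewrite mxE nel_A_mulE trmxK expr2.
Qed.

Variables (c : R).
Hypotheses (c0 : 0 < c) (m0 : (0 < m)%N)
  (quad_ge : forall u, c * m%:R * `|u| ^+ 2 <= quad u).

(** A kernel vector has zero quadratic form, hence zero norm by [quad_ge]. *)
Lemma gram_unitmx : A^T *m A \in unitmx.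
Proof.
rewrite -row_free_unit -kermx_eq0; apply/rowV0P => u /sub_kermxP uG0.
apply/eqP; rewrite -normr_eq0 -sqrf_eq0 eq_le sqr_ge0 andbT.
have := quad_ge u; rewrite -gram_quadE uG0 mul0mx mxE.
by rewrite pmulr_rle0// mulr_gt0// ltr0n.
Qed.

(** Coercivity of the quadratic form bounds the inverse Gram matrix. The factor [n + 1] is the price
    of passing from the sup norm in [quad_ge] to the sum of squares. *)
Lemma sqr_sum_le_gram y : (c * m%:R / (n + 1)%:R) ^+ 2 * (\sum_j y j 0 ^+ 2) <=
  \sum_j ((A^T *m A *m y) j 0) ^+ 2.
Proof.
pose alpha := c * m%:R / (n + 1)%:R.
have alpha0 : 0 < alpha by rewrite divr_gt0 ?mulr_gt0 ?ltr0n ?addn1.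
set s := A^T *m A *m y.
have le1 : alpha * (\sum_j y j 0 ^+ 2) <= \sum_j y j 0 * s j 0.
  have -> : \sum_j y j 0 * s j 0 = quad y^T.
    rewrite -gram_quadE trmxK -mulmxA -/s mxE.
    by apply: eq_bigr => j _; rewrite [y^T _ _]mxE.
  apply: le_trans (quad_ge y^T); rewrite /alpha mulrAC -mulrA ler_wpM2l//.
    by rewrite mulr_ge0 ?ler0n// ltW.
  rewrite ler_pdivrMr ?ltr0n ?addn1// mulr_natr.
  apply: (@le_trans _ _ (\sum_(j < n + 1) `|y^T| ^+ 2)); last first.
    by rewrite sumr_const card_ord.
  apply: ler_sum => j _; rewrite -[leLHS]real_normK ?num_real//.
  by rewrite ler_pXn2r ?nnegrE//; have := ler_mx_norm y^T 0 j; rewrite mxE.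
(* AM-GM: [2 alpha y_j s_j <= (alpha y_j)^2 + s_j^2] *)
have le2 : 2 * alpha * (\sum_j y j 0 * s j 0) <=
    alpha ^+ 2 * (\sum_j y j 0 ^+ 2) + \sum_j s j 0 ^+ 2.
  rewrite !mulr_sumr -big_split/=; apply: ler_sum => j _.
  by have := sqr_ge0 (alpha * y j 0 - s j 0); lra.
by have := ler_wpM2l (ltW alpha0) le1; rewrite -/alpha; lra.
Qed.

End normal_equations.

Lemma enorm_sqr (R : realType) (n : nat) (x : 'cV[R]_n) :
  enorm x ^+ 2 = \sum_(k < n) x k 0 ^+ 2.
Proof. by rewrite sqr_sqrtr// sumr_ge0// => k _; exact: sqr_ge0. Qed.

(** The form at the target is [|a - x|^2 - |a|^2 + s^2], so only noise terms survive. *)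
Lemma range_residual (R : realType) (n : nat) (x a : 'cV[R]_n) (s e : R) :
  (enorm (a - x) + e) ^+ 2 - enorm a ^+ 2 - affine_form (nel_target x s)^T a =
  sqr_range_error s (enorm (a - x)) e.
Proof.
rewrite /sqr_range_error sqrrD !enorm_sqr affine_formE.
rewrite mxE col_mxEd mxE eqxx mulr1n enorm_sqr.
have -> : \sum_(k < n) - 2 * a k 0 * (nel_target x s)^T 0 (lshift 1 k) =
    \sum_(k < n) ((a - x) k 0 ^+ 2 - a k 0 ^+ 2 - x k 0 ^+ 2).
  by apply: eq_bigr => k _; rewrite mxE col_mxEu !mxE; ring.
by rewrite !sumrB; ring.
Qed.

(** The normal equations with the image of the target subtracted from both sides; [range_residual]
    identifies what remains. *)
Lemma nel_error_gram (R : realType) (n : nat) (a : nat -> 'cV[R]_n) (xo : 'cV[R]_n)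
    (s : R) (e : nat -> R) (m : nat) : let A := nel_A a m in
  A^T *m A \in unitmx ->
  A^T *m A *m (nel a (fun i => enorm (a i - xo) + e i) m - nel_target xo s) =
  A^T *m \col_(i < m) sqr_range_error s (enorm (a i - xo)) (e i).
Proof.
move=> A unitA; rewrite mulmxBr /nel -/A -mulmxA mulKVmx// -mulmxA -mulmxBr.
congr (_ *m _); apply/colP => i; rewrite !mxE -range_residual.
by congr (_ - _); rewrite -nel_A_mulE mxE.
Qed.

(** If the linear part is nonzero, a null complement would give the zero hyperplane full mass.
    Otherwise the form is a nonzero constant and the set is the whole space. *)
Lemma affine_form_charged (R : realType) (n : nat)
    (mu : probability (borel_vec R n) R) (u : 'rV[R]_(n + 1)) :
  (~ exists S, affine_subspace n.-1 S /\ mu S = 1%E) -> u != 0 ->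
  mu [set x | affine_form u x != 0] != 0%E.
Proof.
move=> noS u0; apply/eqP => mu0.
have [/existsP[k uk]|/existsPn uk0] := boolP [exists k : 'I_n, u 0 (lshift 1 k) != 0].
  apply: noS; exists [set x | affine_form u x = 0]; split.
    by apply: affine_hyperplane; exists k.
  have -> : [set x | affine_form u x = 0] =
      ~` ([set x | affine_form u x != 0] : set (borel_vec R n)).
    by apply/seteqP; split=> x /=; [move=> ->; rewrite eqxx|move=> /negP/negPn/eqP].
  by rewrite probability_setC ?mu0 ?sube0//; exact: measurable_affine_form.
have formE x : affine_form u x = u 0 (rshift n 0).
  rewrite affine_formE big1 ?add0r// => k _.
  by have := uk0 k; rewrite negbK => /eqP ->; rewrite mulr0.
have ur0 : u 0 (rshift n 0) != 0.
  apply: contraNneq u0 => ur; apply/eqP/rowP => j; rewrite mxE.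
  case: (split_ordP j) => k ->; last by rewrite ord1.
  by have := uk0 k; rewrite negbK => /eqP.
have : mu [set: borel_vec R n] = 0%E.
  by rewrite -mu0; congr (mu _); apply/seteqP; split=> x //= _; rewrite formE.
by rewrite probability_setT => /eqP; rewrite onee_eq0.
Qed.

(** * Stochastic bound on the scaled error *)

Section root_m_consistency.
Context (R : realType) (dsp : measure_display) (T : measurableType dsp)
  (P : probability T R) (n : nat) (xo : 'cV[R]_n) (a : nat -> 'cV[R]_n)
  (r : nat -> {RV P >-> R}) (sigma M : R).
Hypotheses (sigma0 : 0 <= sigma) (hr : iid_gaussian r 0 sigma)
  (aM : forall i k, `|a i k 0| <= M).

Let err m w : 'cV[R]_(n + 1) :=
  nel a (fun i => range_meas a xo r i w) m - nel_target xo sigma.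

Let score m w : 'cV[R]_(n + 1) := (nel_A a m)^T *m
  \col_(i < m) sqr_range_error sigma (enorm (a i - xo)) (r i w).

Let regressor i (j : 'I_(n + 1)) : R :=
  (row_mx ((- 2) *: (a i)^T) 1%:M : 'rV_(n + 1)) 0 j.

Let scoreE m w j : score m w j 0 =
  \sum_(i < m) regressor i j * sqr_range_error sigma (enorm (a i - xo)) (r i w).
Proof.
rewrite mxE; apply: eq_bigr => i _.
by rewrite [X in _ * X]mxE mxE [X in X * _]mxE.
Qed.

Let measurable_score m j : measurable_fun [set: T] (fun w => score m w j 0).
Proof.
under eq_fun do rewrite scoreE.
apply: measurable_sum => i; apply: measurable_funM => //.
apply: measurable_funB => //; apply: measurable_funD; first exact: measurable_funM.
exact: measurable_funX.
Qed.

(** The matrix applied to the data is deterministic, so each entry is a finite linear combination of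
    squared ranges, up to constants. *)
Let measurable_err m j : measurable_fun [set: T] (fun w => err m w j 0).
Proof.
under eq_fun do rewrite mxE [(_ *m _) j 0]mxE.
apply: measurable_funD => //; apply: measurable_sum => i; apply: measurable_funM => //.
under eq_fun do rewrite mxE.
apply: measurable_funB => //; apply: measurable_funX.
exact: measurable_funD.
Qed.

Let norm_regressor i j : `|regressor i j| <= 2 * `|M| + 1.
Proof.
rewrite /regressor; case: (split_ordP j) => k ->.
  rewrite row_mxEl !mxE normrM normrN (@ger0_norm _ 2)//.
  by rewrite ler_wpDr// ler_wpM2l// (le_trans (aM i k))// ler_norm.
by rewrite row_mxEr !mxE !ord1 eqxx normr1 lerDr mulr_ge0.
Qed.

Let enorm_dist_bounded : exists D, forall i, `|enorm (a i - xo)| <= D.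
Proof.
exists (Num.sqrt (\sum_(k < n) (M + `|xo|) ^+ 2)) => i.
rewrite ger0_norm ?sqrtr_ge0// ler_wsqrtr//; apply: ler_sum => k _.
rewrite -[leLHS]real_normK ?num_real// ler_pXn2r ?nnegrE//; last first.
  by rewrite addr_ge0// (le_trans _ (aM i k)).
rewrite !mxE (le_trans (ler_normB _ _))// lerD//.
exact: ler_mx_norm.
Qed.

Let integral_score : exists C : R, forall m,
  (\int[P]_w (\sum_j score m w j 0 ^+ 2)%:E <= (m%:R * C)%:E)%E.
Proof.
have [D aD] := enorm_dist_bounded.
have [C hC] := integral_sqr_sum_range_error sigma0 hr (2 * `|M| + 1) D.
exists ((n + 1)%:R * C) => m; under eq_integral do rewrite -sumEFin.
rewrite ge0_integral_sum//; last 2 first.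
  by move=> j; apply/measurable_EFinP; apply: measurable_funX; exact: measurable_score.
  by move=> j w _; rewrite lee_fin sqr_ge0.
apply: (@le_trans _ _ (\sum_(j < n + 1) (m%:R * C)%:E)%E); last first.
  by rewrite sumEFin sumr_const card_ord lee_fin -[leLHS]mulr_natl mulrCA.
apply: lee_sum => j _; under eq_integral do rewrite scoreE.
exact: (hC (regressor ^~ j) _ m (norm_regressor ^~ j) aD).
Qed.

Variables (c : R) (m0 : nat).
Hypotheses (c0 : 0 < c) (quad_ge : forall m u, (m0 <= m)%N ->
  c * m%:R * `|u| ^+ 2 <= \sum_(i < m) affine_form u (a i) ^+ 2).

(** The squared scaled error [h] is at most [K / m] times the squared score, whose mean is at most
    [m C]; so [h] has mean at most [K |C|], and Markov's inequality applies to [h > N^2]. *)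
Lemma nel_bigOp : bigOp P err (fun m => (Num.sqrt m%:R)^-1).
Proof.
have [C hC] := integral_score.
pose K := ((n + 1)%:R / c) ^+ 2.
have K0 : 0 < K by rewrite exprn_gt0// divr_gt0// ltr0n addn1.
(* With this [N >= 1], [N^2 eps >= N eps = K |C| + eps > K |C|]. The strict [m0 < m] also makes [m]
   positive. *)
move=> eps eps0; exists m0, (K * `|C| / eps + 1) => m m0m.
have mpos : (0 < m)%N by rewrite (leq_ltn_trans _ m0m).
have mR : 0 < m%:R :> R by rewrite ltr0n.
pose N := K * `|C| / eps + 1.
have N1 : 1 <= N by rewrite lerDr divr_ge0 ?(ltW eps0)// mulr_ge0 ?(ltW K0).
have N0 : 0 < N by rewrite (lt_le_trans ltr01).
pose h w := m%:R * \sum_j err m w j 0 ^+ 2.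
have mh : measurable_fun setT h.
  apply: measurable_funM => //; apply: measurable_sum => j.
  by apply: measurable_funX; exact: measurable_err.
have hE w : enorm ((Num.sqrt m%:R)^-1^-1 *: err m w) ^+ 2 = h w.
  rewrite enorm_sqr invrK /h mulr_sumr; apply: eq_bigr => k _.
  by rewrite mxE exprMn sqr_sqrtr// ltW.
have eventE : [set w | N < enorm ((Num.sqrt m%:R)^-1^-1 *: err m w)] =
    h @^-1` `]N ^+ 2, +oo[%classic.
  by apply/seteqP; split=> w /=; rewrite in_itv/= andbT -hE ltr_pXn2r
    ?nnegrE ?sqrtr_ge0 ?(ltW N0).
rewrite eventE; set E := _ @^-1` _.
have mE : measurable E.
  by rewrite -[E]setTI; apply: mh => //; exact: measurable_itv.
have hle w : h w <= K / m%:R * \sum_j score m w j 0 ^+ 2.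
  have qm u : c * m%:R * `|u| ^+ 2 <= \sum_(i < m) affine_form u (a i) ^+ 2.
    exact/quad_ge/ltnW.
  have gramE : (nel_A a m)^T *m nel_A a m *m err m w = score m w.
    exact/nel_error_gram/(gram_unitmx c0 mpos qm).
  have := sqr_sum_le_gram c0 mpos qm (err m w); rewrite gramE => le_score.
  have -> : h w = K / m%:R * ((c * m%:R / (n + 1)%:R) ^+ 2 * \sum_j err m w j 0 ^+ 2).
    rewrite /h mulrA; congr (_ * _); rewrite /K.
    by field; rewrite !gt_eqF// ltr0n addn1.
  by rewrite ler_wpM2l// divr_ge0 ?(ltW K0).
have mW : measurable_fun setT (fun w => \sum_j score m w j 0 ^+ 2).
  by apply: measurable_sum => j; apply: measurable_funX; exact: measurable_score.
have : ((N ^+ 2)%:E * P E <= (K * `|C|)%:E)%E.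
  rewrite -integral_cst//.
  apply: (@le_trans _ _ (\int[P]_(w in E) (K / m%:R * \sum_j score m w j 0 ^+ 2)%:E)%E).
    apply: ge0_le_integral => //.
    - by move=> w _; rewrite lee_fin sqr_ge0.
    - by apply/measurable_EFinP; apply: measurable_funTS; exact: measurable_funM.
    - move=> w; rewrite /E /= in_itv/= andbT lee_fin => /ltW Nh.
      exact: le_trans Nh (hle w).
  apply: (@le_trans _ _ (\int[P]_w (K / m%:R * \sum_j score m w j 0 ^+ 2)%:E)%E).
    apply: ge0_subset_integral => //.
      by apply/measurable_EFinP; exact: measurable_funM.
    move=> w _; rewrite lee_fin mulr_ge0 ?divr_ge0 ?(ltW K0)// sumr_ge0// => j _.
    exact: sqr_ge0.
  under eq_integral do rewrite EFinM.
  rewrite ge0_integralZl//; last 3 first.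
    exact/measurable_EFinP.
    by move=> w _; rewrite lee_fin sumr_ge0// => j _; exact: sqr_ge0.
    by rewrite lee_fin divr_ge0 ?(ltW K0).
  apply: (@le_trans _ _ ((K / m%:R)%:E * (m%:R * C)%:E)%E).
    by rewrite lee_wpmul2l// lee_fin divr_ge0 ?(ltW K0).
  rewrite -EFinM lee_fin mulrA divfK ?gt_eqF//.
  by rewrite ler_wpM2l ?ler_norm// ltW.
have PE : P E \is a fin_num by rewrite fin_num_measure.
rewrite -(fineK PE) -EFinM lee_fin lte_fin => NP.
rewrite ltNge; apply/negP => epsP.
have : N ^+ 2 * eps <= K * `|C| by rewrite (le_trans _ NP)// ler_wpM2l ?sqr_ge0.
apply/negP; rewrite -ltNge; apply: (@lt_le_trans _ _ (N * eps)).
  by rewrite /N mulrDl mul1r divfK ?gt_eqF// ltrDl.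
by rewrite ler_wpM2r ?(ltW eps0)// expr2 ler_peMl ?(ltW N0).
Qed.

End root_m_consistency.

Theorem theorem6 (R : realType) (dsp : measure_display) (T : measurableType dsp)
    (P : probability T R) (n : nat) (hn : n = 2%N \/ n = 3%N)
    (xo : 'cV[R]_n) (a : nat -> 'cV[R]_n) (r : nat -> {RV P >-> R}) (sigma : R)
    (X Aset : set 'cV[R]_n) (mu : probability (borel_vec R n) R)
    (hsigma : 0 <= sigma)
    (hr : iid_gaussian r 0 sigma)
    (hX : compact X) (hxo : interior X xo)
    (hAset : bounded_set Aset) (haA : forall i, Aset (a i))
    (haX : forall i, ~ X (a i))
    (hmu : forall z : 'cV[R]_n, {for z, continuous (df mu)} ->
       sample_df a m z @[m --> \oo] --> df mu z)
    (hline : n = 2%N -> ~ exists S, affine_subspace 1 S /\ mu S = 1%E)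
    (hplane : n = 3%N -> ~ exists S, affine_subspace 2 S /\ mu S = 1%E) :
  (\forall m \near \oo, (nel_A a m)^T *m nel_A a m \in unitmx) /\
  bigOp P
    (fun m w => nel a (fun i => range_meas a xo r i w) m - nel_target xo sigma)
    (fun m => (Num.sqrt m%:R)^-1).
Proof.
(* Lines in the plane and planes in space are both the hyperplanes, of dimension [n.-1]. *)
have no_hyperplane : ~ exists S, affine_subspace n.-1 S /\ mu S = 1%E.
  case: hn => n_eq.
    by rewrite (_ : n.-1 = 1%N) ?n_eq//; exact: hline.
  by rewrite (_ : n.-1 = 2%N) ?n_eq//; exact: hplane.
have [M0 [_ AM]] := hAset.
(* Boundedness provides every bound strictly above [M0], hence the [+ 1]. *)
have aM i k : `|a i k 0| <= M0 + 1.
  rewrite (le_trans (ler_mx_norm (a i) k 0))//.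
  by apply: (AM _ _ (a i)) => //; rewrite ltrDl.
have [c c0 [m0 quad_ge]] := quad_lower_bound aM hmu
  (fun u => @affine_form_charged _ _ mu u no_hyperplane).
split; last exact: (nel_bigOp xo hsigma hr aM c0 quad_ge).
(* Starting past [m0] guarantees a positive [m] for the invertibility of the Gram matrix. *)
exists m0.+1 => // m /= m0m.
apply: (gram_unitmx c0 (leq_ltn_trans _ m0m)) => // u.
exact/quad_ge/ltnW.
Qed.
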